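(* Let $n\ge 1$ and let $(a,b)$ be a finite or infinite open interval of $\mathbb{R}$. Let $\mathcal{G}_n$, $\mathcal{P}_n$, $\mathcal{Q}_{n-1}$ be monic real polynomials of degrees $n$, $n$, $n-1$, respectively, all of whose zeros are real and lie in $(a,b)$. Denote the zeros of $\mathcal{G}_n$ in ascending order by $x_{1,n},\dots,x_{n,n}$. Assume that $\mathcal{G}_n\prec\mathcal{Q}_{n-1}$ and that there exist a real constant $E$ and real polynomials $A(x)$, $B(x)$ with $A(x)>0$ on $(a,b)$ such that $$A(x)\mathcal{P}_n(x)=B(x)\mathcal{G}_n(x)-(x-E)\mathcal{Q}_{n-1}(x).$$ Assume also that $B(E)\ne 0$ and that $\mathcal{G}_n$ and $\mathcal{P}_n$ have no common zeros. Then $(x-E)\mathcal{P}_n(x)\prec\mathcal{G}_n(x)$. In particular, $\mathcal{P}_n\prec\mathcal{G}_n$ whenever $E>x_{n,n}$, while $\mathcal{G}_n\prec\mathcal{P}_n$ whenever $E<x_{1,n}$.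
   Context: Notation $\prec$ for real polynomials $p,q$ with real and distinct zeros: - If $\deg p=\deg q=m$, with zeros $x_1<\dots<x_m$ of $p$ and $y_1<\dots<y_m$ of $q$, then $p\prec q$ means $x_1<y_1<x_2<y_2<\cdots<y_{m-1}<x_m<y_m$. - If $\deg p=m$ and $\deg q=m-1$, with zeros $x_1<\dots<x_m$ of $p$ and $y_1<\dots<y_{m-1}$ of $q$, then $p\prec q$ means $x_1<y_1<x_2<y_2<\cdots<y_{m-1}<x_m$. In particular, $p\prec q$ includes the assertion that the zeros of $p$ and of $q$ are real and distinct. *)

(* Defs.v *)
From mathcomp Require Export all_boot all_order all_algebra.
From mathcomp Require Export reals constructive_ereal.
From mathcomp Require Export complex.

Set Implicit Arguments.
Unset Strict Implicit.
Unset Printing Implicit Defensive.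

Import Order.TTheory GRing.Theory Num.Theory.
Local Open Scope ring_scope.

(* The zeros are those in the complex numbers R[i]: each must be the image of
   a real number of I.  Intervals have extended real bounds so that they may
   be unbounded. *)
Definition zeros_real_in (R : realType) (I : interval (\bar R))
    (p : {poly R}) : Prop :=
  forall z : R[i], root (map_poly (real_complex R) p) z ->
    exists2 x : R, z = real_complex R x & x%:E \in I.

(* p has degree m = size xs and xs = [:: x_1; ...; x_m], x_1 < ... < x_m,
   lists its zeros; since there are m = deg p of them, p has no other complex
   zeros and all of them are simple. *)
Definition ordered_zeros (R : realType) (p : {poly R}) (xs : seq R) : Prop :=
  [/\ size p = (size xs).+1, sorted <%R xs & forall x, root p x = (x \in xs)].

(* x_1 < y_1 < x_2 < y_2 < ..., ending with y_m if both lists have size m and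
   with x_m if ys has size m - 1; sequences are indexed from 0. *)
Definition interlace (R : realType) (xs ys : seq R) : Prop :=
  [/\ size xs = size ys \/ size xs = (size ys).+1,
      forall i, (i < size ys)%N -> xs`_i < ys`_i
    & forall i, (i.+1 < size xs)%N -> ys`_i < xs`_i.+1].

Definition prec (R : realType) (p q : {poly R}) : Prop :=
  exists xs ys : seq R,
    [/\ ordered_zeros p xs, ordered_zeros q ys & interlace xs ys].
Notation "p ≺ q" := (prec p q) (at level 70, no associativity) : ring_scope.

(* Main.v *)
(* At a zero x_k of G the identity reads A P = - (x_k - E) Q, and x_k <> E since
   otherwise x_k would be a common zero of G and P.  Hence F = (x - E) P
   satisfies A F = - (x_k - E)^2 Q there, so F has the sign opposite to that of
   Q, which alternates by G ≺ Q and is positive at the last zero.  Comparing with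
   the signs of F at both infinities, the intermediate value theorem provides
   n + 1 zeros of F interlacing with those of G.  When E lies beyond all zeros
   of G it is an extreme zero of F and can be discarded. *)
Require Import Defs.
From mathcomp Require Import boolp polyrcf.
From mathcomp Require Import zify ring lra.

Import Order.TTheory GRing.Theory Num.Theory.
Local Open Scope ring_scope.

Lemma ordered_zeros_factor (R : realType) (p : {poly R}) (xs : seq R) :
  p \is monic -> ordered_zeros p xs -> p = \prod_(z <- xs) ('X - z%:P).
Proof.
move=> /monicP mp [sp sxs rp].
rewrite {1}(@all_roots_prod_XsubC _ p xs) ?mp ?scale1r //.
  by apply/allP => z; rewrite rp.
by rewrite uniq_rootsE (lt_sorted_uniq sxs).
Qed.

(** Since [prec] hides its lists of zeros under existentials, this is what identifies them with the
    given list [x]. *)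
Lemma ordered_zeros_unique (R : realType) (p : {poly R}) (xs ys : seq R) :
  ordered_zeros p xs -> ordered_zeros p ys -> xs = ys.
Proof.
move=> [_ sx rx] [_ sy ry]; apply: lt_sorted_eq => // z.
by rewrite -rx -ry.
Qed.

Lemma lt_sorted_le_nth (R : realType) (s : seq R) (i j : nat) :
  sorted <%R s -> (i <= j)%N -> (j < size s)%N -> s`_i <= s`_j.
Proof.
move=> ss ij js; rewrite (lt_sorted_leq_nth 0 ss) //.
exact: leq_ltn_trans js.
Qed.

(** With [k] zeros below [t], exactly the other [size ys - k] linear factors of [p] are negative at
    [t]. *)
Lemma ordered_zeros_sign (R : realType) (p : {poly R}) (ys : seq R) (t : R)
    (k : nat) :
  p \is monic -> ordered_zeros p ys ->
  (forall i, (i < k)%N -> (i < size ys)%N -> ys`_i < t) ->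
  (forall i, (k <= i)%N -> (i < size ys)%N -> t < ys`_i) ->
  0 < (-1) ^+ (size ys - k) * p.[t].
Proof.
move=> mp /(ordered_zeros_factor _ _ _ mp) -> {p mp}.
elim: ys k => [|y ys IH] k lo hi; first by rewrite big_nil hornerC expr0 mulr1.
rewrite big_cons hornerM hornerXsubC.
case: k lo hi => [|k] lo hi.
  have := IH 0 (fun i => ltac:(done)) (fun i _ h => hi i.+1 isT h).
  rewrite !subn0 /= exprS => h.
  have := hi 0 isT isT => /= ty.
  by rewrite mulrACA mulr_gt0 //; lra.
have := IH k (fun i a b => lo i.+1 a b) (fun i a b => hi i.+1 a b).
rewrite /= subSS mulrCA => h; rewrite mulr_gt0 ?subr_gt0 //.
exact: (lo 0 isT isT).
Qed.

(** The [deg p + 1] points of [w] bound [deg p] gaps. Each contains a zero by the intermediate value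
    theorem, and the degree leaves room for no other. *)
Lemma alternating_zeros (R : realType) (p : {poly R}) (w : seq R) :
  p != 0 -> size p = size w ->
  (forall k, (k.+1 < size w)%N -> w`_k < w`_k.+1 /\ p.[w`_k] * p.[w`_k.+1] < 0) ->
  exists2 zs : seq R, ordered_zeros p zs &
    forall k, (k < size zs)%N -> w`_k < zs`_k < w`_k.+1.
Proof.
move=> p0 sp alt.
have /choice[f fP] k : exists z, (k.+1 < size w)%N ->
    (w`_k < z < w`_k.+1) && root p z.
  (* The value 0 past the last gap only makes the choice function total. *)
  case: (ltnP k.+1 (size w)) => [kw|]; last by exists 0.
  have [lt_w sgn] := alt k kw.
  have [z zin rz] := poly_ivtoo (ltW lt_w) sgn.
  by exists z; move: zin; rewrite in_itv /= rz andbT.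
have sw : (0 < size w)%N by rewrite -sp size_poly_gt0.
pose zs := mkseq f (size w).-1.
have szs : size zs = (size w).-1 by rewrite size_mkseq.
have zsP k : (k < size zs)%N -> w`_k < zs`_k < w`_k.+1.
  rewrite szs => kz; rewrite nth_mkseq //.
  by case/andP: (fP k ltac:(lia)).
exists zs => //.
have sorted_zs : sorted <%R zs.
  apply/(sortedP 0) => i iz.
  have /andP[_ h1] := zsP i (ltnW iz).
  by have /andP[h2 _] := zsP _ iz; apply: lt_trans h2.
have root_zs : all (root p) zs.
  apply/allP => z /mapP[k]; rewrite mem_iota => /andP[_ kz] ->.
  by case/andP: (fP k ltac:(lia)).
split=> //; first by rewrite sp szs prednK.
move=> z; apply/idP/idP => [rz|]; last exact: (allP root_zs).
apply/negPn/negP => zN.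
have := @max_poly_roots _ p (z :: zs) p0.
by rewrite /= rz root_zs zN (lt_sorted_uniq sorted_zs) sp szs prednK // ltnn => /(_ isT isT).
Qed.

Lemma alternating_prec (R : realType) (G F : {poly R}) (x : seq R) :
  F \is monic -> size F = (size x).+2 -> ordered_zeros G x ->
  (forall k, (k < size x)%N -> 0 < (-1) ^+ (size x - k) * F.[x`_k]) ->
  F ≺ G.
Proof.
move=> mF sF Gx sgn.
have F0 : F != 0 by rewrite monic_neq0.
have [_ sx _] := Gx.
(* Beyond the Cauchy bound [F] keeps its sign at infinity; the sum exceeds every [|x_k|], strictly
   thanks to the summand 1. *)
pose M := Num.max (cauchy_bound F) (\sum_(y <- x) (1 + `|y|)).
have Mx k : (k < size x)%N -> - M < x`_k < M.
  move=> kx; rewrite -ltr_norml lt_max; apply/orP; right.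
  rewrite (big_nth 0) big_mkord (bigD1 (Ordinal kx)) //=.
  have : 0 <= \sum_(i < size x | i != Ordinal kx) (1 + `|x`_i|).
    by apply: sumr_ge0 => i _; rewrite addr_ge0.
  by lra.
have M0 : 0 < M by rewrite lt_max cauchy_bound_gt0.
have cM : cauchy_bound F <= M by rewrite le_max lexx.
have hiM : 0 < F.[M].
  rewrite -sgr_gt0 (sgp_pinftyP (ge_cauchy_bound F0)) ?in_itv /= ?andbT //.
  by rewrite /sgp_pinfty (monicP mF) sgr1.
have loM : 0 < (-1) ^+ (size x).+1 * F.[- M].
  rewrite -sgr_gt0 sgrM (sgp_minftyP (le_cauchy_bound F0)).
    rewrite /sgp_minfty (monicP mF) mulr1 sF /= -sgrM -exprMn.
    by rewrite mulrNN mulr1 expr1n sgr1.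
  by rewrite in_itv /= lerN2.
pose w := - M :: rcons x M.
have sw : size w = (size x).+2 by rewrite /= size_rcons.
have wS k : (k < size x)%N -> w`_k.+1 = x`_k.
  by move=> kx; rewrite /= nth_rcons kx.
have wM : w`_(size x).+1 = M by rewrite /= nth_rcons ltnn eqxx.
(* As [w] carries [- M] in front, [x_k] has index [k + 1] in it. One exponent then fits the zeros of
   [G] and both end points. *)
have sgnw k : (k < size w)%N -> 0 < (-1) ^+ ((size x).+1 - k) * F.[w`_k].
  rewrite sw; case: k => [|k] kw; first by rewrite subn0.
  rewrite subSS; have [kx|kx] := ltnP k (size x); first by rewrite wS ?sgn.
  have -> : k = size x by lia.
  by rewrite wM subnn mul1r.
have ltw k : (k.+1 < size w)%N -> w`_k < w`_k.+1.
  rewrite sw; have [kx|kx] := ltnP k (size x).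
    rewrite wS //; case: k kx => [|k] kx _.
      by have /andP[] := Mx _ kx.
    by rewrite wS ?(ltnW kx) //; apply: (sortedP 0 sx).
  move=> kw; have -> : k = size x by lia.
  (* If [x] is empty, the last gap is [- M < M], which is where [M0] enters. *)
  rewrite wM; case E : (size x) => [|m]; first by rewrite /=; lra.
  by rewrite wS ?E //; have /andP[] := Mx m ltac:(lia).
have [|k kw|zs Fzs zsP] := alternating_zeros _ F w F0.
- by rewrite sF sw.
- split; first exact: ltw.
  (* Consecutive exponents differ by one, so multiplying the two positive quantities gives minus the
     product of the two values of [F]. *)
  have := sgnw _ kw; have := sgnw _ (ltnW kw).
  have -> : ((size x).+1 - k = ((size x).+1 - k.+1).+1)%N by rewrite sw in kw; lia.
  rewrite exprS => h1 h2; have := mulr_gt0 h1 h2.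
  rewrite !mulN1r mulrACA mulNr -expr2 sqrr_sign.
  lra.
exists zs, x; split=> //.
have szs : size zs = (size x).+1 by case: Fzs; rewrite sF => -[].
split; first by right.
- move=> i ix; rewrite -(wS _ ix).
  by have /andP[] := zsP i ltac:(lia).
- move=> i; rewrite szs => ix; rewrite -wS //.
  by have /andP[] := zsP i.+1 ltac:(lia).
Qed.

(** Once the product is factored over its zeros, the nonzero factor ['X - E%:P] cancels. *)
Lemma ordered_zeros_remove (R : realType) (P : {poly R}) (E : R)
    (s1 s2 : seq R) :
  P \is monic -> ordered_zeros (('X - E%:P) * P) (s1 ++ E :: s2) ->
  ordered_zeros P (s1 ++ s2).
Proof.
move=> mP FZ.
have mF : ('X - E%:P) * P \is monic by rewrite monicMr ?monicXsubC.
have : 'X - E%:P != 0 by rewrite monic_neq0 ?monicXsubC.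
have := ordered_zeros_factor _ _ _ mF FZ.
rewrite big_cat big_cons /= mulrCA -big_cat /= => PE /mulfI/(_ _ _ PE) {}PE.
case: FZ => _ srt _; split.
- by rewrite PE size_prod_XsubC.
- apply: subseq_sorted srt; first exact: lt_trans.
  by rewrite cat_subseq ?subseq_cons.
- by move=> t; rewrite PE root_prod_XsubC.
Qed.

Theorem theorem2p2 (R : realType) (n : nat) (a b : \bar R)
    (G P Q : {poly R}) (x : seq R) (E : R) (A B : {poly R}) :
  (1 <= n)%N ->
  (a < b)%E ->
  G \is monic -> P \is monic -> Q \is monic ->
  size G = n.+1 -> size P = n.+1 -> size Q = (n.-1).+1 ->
  zeros_real_in `]a, b[ G ->
  zeros_real_in `]a, b[ P ->
  zeros_real_in `]a, b[ Q ->
  ordered_zeros G x ->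
  G ≺ Q ->
  (forall t : R, t%:E \in `]a, b[ -> 0 < A.[t]) ->
  A * P = B * G - ('X - E%:P) * Q ->
  B.[E] != 0 ->
  (forall t : R, ~ (root G t /\ root P t)) ->
  [/\ (('X - E%:P) * P) ≺ G,
      x`_n.-1 < E -> P ≺ G
    & E < x`_0 -> G ≺ P].
Proof.
move=> n1 _ mG mP mQ sG sP sQ zG _ _ Gx GQ Apos AP _ GP.
have [szG sx rG] := Gx.
have sz : size x = n by move: szG; rewrite sG => -[].
have mF : ('X - E%:P) * P \is monic by rewrite monicMr ?monicXsubC.
have sF : size (('X - E%:P) * P) = (size x).+2.
  by rewrite size_monicM ?monicXsubC ?monic_neq0 // size_XsubC sP sz.
have prec_FG : (('X - E%:P) * P) ≺ G.
  apply: (alternating_prec _ _ _ _ mF sF Gx) => k kx.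
  have rGk : root G x`_k by rewrite rG mem_nth.
  have Ak : 0 < A.[x`_k].
    (* The location of the zeros is stated over the complex numbers, so [x_k] is embedded there and
       recovered by injectivity. *)
    have rz : root (map_poly (real_complex R) G) (real_complex R x`_k).
      by rewrite fmorph_root.
    have [t te tI] := zG _ rz.
    by apply: Apos; rewrite (complexI te).
  have APk : A.[x`_k] * P.[x`_k] = - ((x`_k - E) * Q.[x`_k]).
    have := congr1 (fun p => p.[x`_k]) AP.
    by rewrite !hornerE (rootP rGk) mulr0 sub0r.
  have xkE : x`_k - E != 0.
    apply/negP => /eqP xE; apply: (GP x`_k); split=> //; apply/rootP.
    by move/eqP: APk; rewrite xE mul0r oppr0 mulf_eq0 (gt_eqF Ak) => /eqP.
  have [xs [ys [/(ordered_zeros_unique _ _ _ _ Gx) <- Qy [_ lo hi]]]] := GQ.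
  have sy : size ys = n.-1 by case: Qy => + _ _; rewrite sQ => -[].
  have [_ sorted_y _] := Qy.
  have y_le i j : (i <= j)%N -> (j < size ys)%N -> ys`_i <= ys`_j.
    exact: lt_sorted_le_nth.
  have Qk : 0 < (-1) ^+ (size ys - k) * Q.[x`_k].
    (* Counting from 0, [y_(k-1) < x_k < y_k], so exactly [k] zeros of [Q] lie below [x_k]. *)
    apply: (ordered_zeros_sign _ _ _ _ _ mQ Qy) => i.
      case: k kx {rGk Ak APk xkE} => [//|k] kx ik iy.
      by apply: le_lt_trans (hi k kx); apply: y_le; lia.
    by move=> ki iy; apply: lt_le_trans (lo k ltac:(lia)) (y_le _ _ ki iy).
  (* Multiplying by [A > 0] makes [APk] applicable. Its minus sign is absorbed by the extra factor
     -1 that comes from [n - k = (n - 1 - k) + 1]. *)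
  rewrite -(pmulr_rgt0 _ Ak) hornerM hornerXsubC.
  have -> : (size x - k = (size ys - k).+1)%N by lia.
  rewrite exprS.
  have -> : A.[x`_k] * (-1 * (-1) ^+ (size ys - k) * ((x`_k - E) * P.[x`_k]))
     = (x`_k - E) ^+ 2 * ((-1) ^+ (size ys - k) * Q.[x`_k]).
    transitivity (- ((-1) ^+ (size ys - k) * (x`_k - E) * (A.[x`_k] * P.[x`_k]))).
      by ring.
    by rewrite APk; ring.
  by rewrite mulr_gt0 // exprn_even_gt0.
split=> //.
- move=> xE.
  have [zs [xs [Fz /(ordered_zeros_unique _ _ _ _ Gx) <- [_ lo hi]]]] := prec_FG.
  have [szF sorted_z rF] := Fz.
  have szs : size zs = n.+1 by move: szF; rewrite sF sz => -[].
  have : E \in zs by rewrite -rF rootM root_XsubC eqxx.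
  case/lastP: zs szs Fz lo hi {szF sorted_z rF} => [//|zs z].
  rewrite size_rcons => -[szs] Fz lo hi.
  (* Every zero of [F] but the last lies below some zero of [G], hence below [E]; so [E] is the last
     one. *)
  have -> : (E \in rcons zs z) = (E == z).
    rewrite mem_rcons inE; case: eqP => //= _; apply/negP => /(nthP 0)[i iz Ei].
    have ix : (i < size x)%N by rewrite sz -szs.
    have := lo i ix; rewrite nth_rcons iz Ei ltNge => /negP; apply.
    by apply: ltW; apply: le_lt_trans xE; apply: lt_sorted_le_nth => //; lia.
  move=> /eqP Ez; subst z.
  exists zs, x; split=> //.
    by have := ordered_zeros_remove _ P E zs [::] mP; rewrite cats1 cats0; apply.
  split; first by left; rewrite szs sz.
  - by move=> i ix; have := lo i ix; rewrite nth_rcons szs -sz ix.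
  - by move=> i iz; have := hi i (leqW iz); rewrite nth_rcons iz.
- move=> Ex.
  have [zs [xs [Fz /(ordered_zeros_unique _ _ _ _ Gx) <- [_ lo hi]]]] := prec_FG.
  have [szF sorted_z rF] := Fz.
  have szs : size zs = n.+1 by move: szF; rewrite sF sz => -[].
  have : E \in zs by rewrite -rF rootM root_XsubC eqxx.
  case: zs szs Fz lo hi {szF sorted_z rF} => [//|z zs] /= [szs] Fz lo hi.
  (* Every zero of [F] but the first lies above some zero of [G], hence above [E]; so [E] is the
     first one. *)
  rewrite inE => /orP[/eqP Ez|/(nthP 0)[i iz Ei]]; last first.
    have := hi i iz; rewrite /= Ei ltNge => /negP; case.
    by apply: ltW; apply: lt_le_trans Ex _; apply: lt_sorted_le_nth => //; rewrite sz -szs.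
  subst z.
  exists x, zs; split=> //.
    exact: ordered_zeros_remove _ P E [::] zs mP Fz.
  split; first by left; rewrite szs sz.
  (* Dropping the first zero shifts the indices by one, so the two families of inequalities exchange
     their roles. *)
  - by move=> i iz; apply: (hi i).
  - by move=> i ix; apply: (lo i.+1).
Qed.
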